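(* Let $N$ be the incidence matrix of a symmetric $(v,k,\lambda)$-design, let $t\in\mathbb{C}$, and suppose $W=(t-1)N+J$ is a type-II matrix. If $v>3$ and $t\neq -1$, then the Nomura algebra $\mathcal{N}_W$ is trivial, i.e. $\dim\mathcal{N}_W=2$ (so $\mathcal{N}_W$ is spanned by $I$ and $J$).
   Context: $J$ is the all-ones matrix. A $v\times v$ $01$-matrix $N$ is the incidence matrix of a symmetric $(v,k,\lambda)$-design if $k>\lambda\ge0$, all row and column sums of $N$ equal $k$, and $NN^T=(k-\lambda)I+\lambda J$. For a matrix $W$ with non-zero entries, $W^{(-)}$ is its entrywise inverse and $\circ$ the entrywise product; $W$ ($v\times v$) is type-II if $W(W^{(-)})^T=vI$. With standard basis vectors $e_a$, set $Y_{a,b}:=We_a\circ W^{(-)}e_b$; the Nomura algebra $\mathcal{N}_W$ is the set of $v\times v$ complex matrices having every $Y_{a,b}$ as an eigenvector. It always contains $I$ and $J$ when $W$ is type-II. *)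

(* Defs.v *)
From HB Require Import structures.
From mathcomp Require Import all_boot all_order all_algebra.
From mathcomp Require Import reals.
From mathcomp Require Import complex.

Set Implicit Arguments.
Unset Strict Implicit.
Unset Printing Implicit Defensive.

Import Order.TTheory GRing.Theory Num.Theory.
Local Open Scope ring_scope.

Definition allones (F : pzSemiRingType) (v : nat) : 'M[F]_v := const_mx 1.

(* The incidence matrix is taken directly with entries in F, so that it can
   be combined with complex scalars. *)
Definition symmetric_design (F : pzRingType) (v k lambda : nat) (N : 'M[F]_v)
  : Prop :=
  [/\ (lambda < k)%N,
      forall i j, N i j = 0 \/ N i j = 1,
      forall i, \sum_j N i j = k%:R,
      forall j, \sum_i N i j = k%:R
    & N *m N^T = (k%:R - lambda%:R)%:M + lambda%:R *: allones F v].

Section TypeII.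
Variable F : fieldType.

Definition einv (m n : nat) (A : 'M[F]_(m, n)) : 'M[F]_(m, n) :=
  map_mx (@GRing.inv F) A.

Definition eprod (m n : nat) (A B : 'M[F]_(m, n)) : 'M[F]_(m, n) :=
  map2_mx (@GRing.mul F) A B.

(* The first conjunct is needed because 0^-1 = 0 in a fieldType. *)
Definition typeII (v : nat) (W : 'M[F]_v) : Prop :=
  (forall i j, W i j != 0) /\ W *m (einv W)^T = (v%:R)%:M.

Definition ebasis (v : nat) (a : 'I_v) : 'cV[F]_v := delta_mx a 0.

Definition Yvec (v : nat) (W : 'M[F]_v) (a b : 'I_v) : 'cV[F]_v :=
  eprod (W *m ebasis a) (einv W *m ebasis b).

(* Column eigenvectors; the library's eigenspace is about row vectors. *)
Definition eigenvector (v : nat) (M : 'M[F]_v) (y : 'cV[F]_v) : Prop :=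
  y != 0 /\ exists theta : F, M *m y = theta *: y.

Definition nomura (v : nat) (W : 'M[F]_v) (M : 'M[F]_v) : Prop :=
  forall a b : 'I_v, eigenvector M (Yvec W a b).

End TypeII.

(* The set S of vectors is the underlying set of the subspace U. *)
Definition is_carrier (F : fieldType) (V : vectType F) (S : V -> Prop)
    (U : {vspace V}) : Prop :=
  forall x, S x <-> x \in U.

(* Main.v *)
Require Import Defs.
From HB Require Import structures.
From mathcomp Require Import all_boot all_order all_algebra.
From mathcomp Require Import reals.
From mathcomp Require Import complex.
From mathcomp Require Import ring.

Set Implicit Arguments.
Unset Strict Implicit.
Unset Printing Implicit Defensive.

Import Order.TTheory GRing.Theory Num.Theory.
Local Open Scope ring_scope.

(** Let [theta a b] be the eigenvalue of [M] on [Yvec W a b].  For fixed [d] the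
    vectors [Yvec W c d] form a basis whose dual basis is, up to the factor [v],
    [Yvec W d c]; hence [theta a b = theta c d] as soon as [Yvec W a b] and
    [Yvec W d c] are not orthogonal.  For three distinct columns [a, b, c] the
    products [Y_ab . Y_ac] and [Y_ca . Y_ba] are affine functions of the number
    of common ones of the three columns, exchanged by [t <-> 1/t], and they
    cannot both vanish unless [t = -1].  So [theta a b = theta c a] for all
    distinct [a, b, c], and with a fourth column available this makes [theta]
    constant off the diagonal. *)

(** * Dual bases of the vectors [Yvec] and equality of eigenvalues *)

Lemma YvecE (F : fieldType) (v : nat) (W : 'M[F]_v) (a b : 'I_v) x :
  Yvec W a b x 0 = W x a / W x b.
Proof. by rewrite /Yvec /eprod mxE -!colE !mxE. Qed.

Lemma mul_Yvec (F : fieldType) (v : nat) (W : 'M[F]_v) (a b c d : 'I_v) :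
  ((Yvec W d c)^T *m Yvec W a b) 0 0
    = \sum_x (W x d / W x c) * (W x a / W x b).
Proof. by rewrite mxE; apply: eq_bigr => x _; rewrite mxE !YvecE. Qed.

(** A one-sided inverse of a square matrix is two-sided, so the orthogonality of the rows of [W]
    passes to its columns. *)
Lemma typeII_col (F : fieldType) (v : nat) (W : 'M[F]_v) :
  v%:R != 0 :> F -> typeII W ->
  forall a c, \sum_x W x a / W x c = (v%:R : F) *+ (a == c).
Proof.
move=> v0 [_ WW] a c.
have : ((v%:R)^-1 *: (einv W)^T) *m W = 1%:M.
  by apply: mulmx1C; rewrite -scalemxAr WW scale_scalar_mx mulVf.
rewrite -scalemxAl => /(congr1 (fun A => v%:R *: A)).
rewrite scalerA divff // scale1r => /matrixP/(_ c a).
rewrite !mxE mulr_natr eq_sym => <-.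
by apply: eq_bigr => x _; rewrite !mxE mulrC.
Qed.

Definition Ybasis (F : fieldType) (v : nat) (W : 'M[F]_v) (d : 'I_v) : 'M[F]_v :=
  \matrix_(x, c) Yvec W c d x 0.

Lemma col_Ybasis (F : fieldType) (v : nat) (W : 'M[F]_v) (c d : 'I_v) :
  col c (Ybasis W d) = Yvec W c d.
Proof. by apply/matrixP => x i; rewrite !mxE ord1. Qed.

Lemma col_mulmx (F : fieldType) (m n p : nat) (A : 'M[F]_(m, n))
    (B : 'M[F]_(n, p)) (j : 'I_p) : col j (A *m B) = A *m col j B.
Proof. by rewrite !colE mulmxA. Qed.

Lemma eq_col (F : Type) (m n : nat) (A B : 'M[F]_(m, n)) :
  (forall j, col j A = col j B) -> A = B.
Proof.
by move=> AB; apply/matrixP => i j; have /colP/(_ i) := AB j; rewrite !mxE.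
Qed.

(** The entries of column [d] cancel in the product, leaving the relation between columns [a] and
    [c]. *)
Lemma Yvec_dual (F : fieldType) (v : nat) (W : 'M[F]_v) :
  v%:R != 0 :> F -> typeII W ->
  forall a c d, (Yvec W d c)^T *m Yvec W a d = ((v%:R : F) *+ (a == c))%:M.
Proof.
move=> v0 tW a c d; apply/matrixP => i j; rewrite !ord1 mul_Yvec mxE eqxx mulr1n.
rewrite -(typeII_col v0 tW); apply: eq_bigr => x _.
by rewrite mulrC mulrA divfK //; case: tW.
Qed.

Lemma Ybasis_unit (F : fieldType) (v : nat) (W : 'M[F]_v) (d : 'I_v) :
  v%:R != 0 :> F -> typeII W -> Ybasis W d \in unitmx.
Proof.
move=> v0 tW.
pose D : 'M[F]_v := \matrix_(c, x) ((v%:R)^-1 * Yvec W d c x 0).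
suff DB : D *m Ybasis W d = 1%:M by case/mulmx1_unit: DB.
apply/matrixP => c a.
have /matrixP/(_ 0 0) := Yvec_dual v0 tW a c d.
rewrite mul_Yvec mxE eqxx mulr1n => /(congr1 ( *%R (v%:R)^-1)).
rewrite mulrnAr mulVf // eq_sym [1%:M _ _]mxE => <-; rewrite mxE.
rewrite mulr_sumr; apply: eq_bigr => x _.
by rewrite [D _ _]mxE [Ybasis _ _ _ _]mxE !YvecE -!mulrA.
Qed.

Lemma eigenvalue_eq (F : fieldType) (v : nat) (W M : 'M[F]_v)
    (theta : 'I_v -> 'I_v -> F) :
  v%:R != 0 :> F -> typeII W ->
  (forall a b, M *m Yvec W a b = theta a b *: Yvec W a b) ->
  forall a b c d,
    \sum_x (W x d / W x c) * (W x a / W x b) != 0 -> theta a b = theta c d.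
Proof.
move=> v0 tW Mth a b c d; rewrite -mul_Yvec => S0.
set r := (Yvec W d c)^T in S0.
(* [r] is a left eigenvector of [M]: tested against the basis [Yvec W e d], both sides vanish unless
   [e = c]. *)
have rM : r *m M = theta c d *: r.
  apply: (can_inj (mulmxK (Ybasis_unit d v0 tW))).
  apply: eq_col => e; rewrite !col_mulmx col_Ybasis -mulmxA Mth -scalemxAl -scalemxAr.
  rewrite (Yvec_dual v0 tW); case: (eqVneq e c) => [->//|_].
  by rewrite mulr0n raddf0 !scaler0.
(* The scalar [r *m M *m Yvec W a b] is now computed from either side. *)
apply: (mulIf S0).
have : r *m (M *m Yvec W a b) = theta c d *: (r *m Yvec W a b).
  by rewrite mulmxA rM scalemxAl.
by rewrite Mth -scalemxAr => /matrixP/(_ 0 0); rewrite !(mxE scalemx_key).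
Qed.

(** * Sums of products over three columns of the design *)

(** For a 01-matrix [N], a power of an entry of [W] is affine in the entry of [N]: exponent [e]
    gives [1 + (t^e - 1) N]. This expansion thus reduces products of entries of [W] to counts of
    common ones. *)
Lemma sum_prod3 (F : comPzRingType) (v : nat) (f g h : 'I_v -> F) (x y z : F) :
  \sum_i (1 + x * f i) * (1 + y * g i) * (1 + z * h i) =
  v%:R + x * (\sum_i f i) + y * (\sum_i g i) + z * (\sum_i h i)
  + x * y * (\sum_i f i * g i) + x * z * (\sum_i f i * h i)
  + y * z * (\sum_i g i * h i) + x * y * z * (\sum_i f i * g i * h i).
Proof.
have -> : (v%:R : F) = \sum_(i < v) 1 by rewrite sumr_const card_ord.
rewrite !mulr_sumr -!big_split; apply: eq_bigr => i _ /=; ring.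
Qed.

(** After substitution of [v], the sum times [t ^+ 2] is the conclusion's left side times
    [(t - 1) ^+ 2 * (t + 1)]. Here [k], [p] and [mu] stand for the numbers of common ones of one,
    two and three columns. *)
Lemma triple_sum_eq0 (F : fieldType) (v : F) (t k p mu : F) :
  t != 0 -> t != 1 -> t != -1 ->
  v = (2 - t - t^-1) * (k - p) ->
  v + (t ^+ 2 - 1) * k + (t^-1 - 1) * k + (t^-1 - 1) * k
  + (t ^+ 2 - 1) * (t^-1 - 1) * p + (t ^+ 2 - 1) * (t^-1 - 1) * p
  + (t^-1 - 1) * (t^-1 - 1) * p
  + (t ^+ 2 - 1) * (t^-1 - 1) * (t^-1 - 1) * mu = 0 ->
  (t - 1) * (mu - p) + t * (k - p) = 0.
Proof.
move=> t0 t1 tN1 -> S0.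
have c0 : (t - 1) ^+ 2 * (t + 1) != 0.
  by rewrite mulf_neq0 ?expf_neq0 ?subr_eq0 // -[1]opprK subr_eq0.
apply: (mulfI c0); rewrite mulr0 -[RHS](mulr0 (t ^+ 2)) -S0.
by field.
Qed.

(** Either excluded value would make [W] the all-ones matrix, whose columns are not orthogonal; for
    [t = 0], nonzero entries of [W] force [N = 0]. *)
Lemma design_typeII_scalar (F : fieldType) (v : nat) (N : 'M[F]_v) (t : F) :
  v%:R != 0 :> F -> (1 < v)%N ->
  (forall i j, N i j = 0 \/ N i j = 1) ->
  typeII ((t - 1) *: N + allones F v) -> t != 0 /\ t != 1.
Proof.
move=> v0 v1 N01 tW; have v_gt0 := ltnW v1.
pose i0 := Ordinal v_gt0; pose i1 := Ordinal v1.
set W := _ + _ in tW.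
have notJ : ~ (forall i j, W i j = 1).
  move=> WJ; have := typeII_col v0 tW i0 i1.
  under eq_bigr do rewrite !WJ divr1.
  by rewrite sumr_const card_ord => /eqP; rewrite (negPf v0).
split; apply/eqP => t_eq; apply: notJ => i j.
  have := tW.1 i j; rewrite !mxE t_eq.
  by case: (N01 i j) => ->; [rewrite mulr0 add0r | rewrite mulr1 subrK eqxx].
by rewrite !mxE t_eq subrr mul0r add0r.
Qed.

(** Both sums compare the eigenvalues on [Yvec W a b] and [Yvec W c a], so one nonzero sum is
    enough. *)
Lemma design_adjacent (F : fieldType) (v : nat) (N : 'M[F]_v) (t k : F)
    (W := (t - 1) *: N + allones F v) :
  v%:R != 0 :> F -> (1 < v)%N ->
  (forall i j, N i j = 0 \/ N i j = 1) ->
  (forall j, \sum_i N i j = k) ->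
  typeII W -> t != -1 ->
  forall a b c, a != b -> a != c -> b != c ->
    \sum_x (W x a / W x c) * (W x a / W x b) != 0 \/
    \sum_x (W x b / W x a) * (W x c / W x a) != 0.
Proof.
move=> v0 v1 N01 Nk tW tN1 a b c ab ac bc.
have [t0 t1] := design_typeII_scalar v0 v1 N01 tW.
have tV1 : t^-1 != 1 by rewrite invr_eq1.
have tVN1 : t^-1 != -1 by rewrite -(inj_eq invr_inj) invrK invrN1.
have tV0 : t^-1 != 0 by rewrite invr_eq0.
have s0 : 2 - t - t^-1 != 0.
  have -> : 2 - t - t^-1 = - ((t - 1) ^+ 2 / t) by field.
  by rewrite oppr_eq0 mulf_neq0 // expf_neq0 // subr_eq0.
(* Orthogonality of two columns of [W] forces this number of common ones. *)
pose p := k - v%:R / (2 - t - t^-1).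
have pE d e : d != e -> \sum_x N x d * N x e = p.
  move=> de.
  have S0 : \sum_x W x d / W x e = 0.
    by rewrite (typeII_col v0 tW) (negPf de).
  (* The dummy third factor brings the product into the shape of [sum_prod3]. *)
  have WE x : W x d / W x e =
      (1 + (t - 1) * N x d) * (1 + (t^-1 - 1) * N x e) * (1 + 0 * 0).
    by rewrite !mxE; case: (N01 x d) => ->; case: (N01 x e) => ->; field;
       rewrite ?t0 //= ?subrK ?oner_eq0.
  have := S0; under eq_bigr do rewrite WE.
  rewrite (@sum_prod3 _ _ _ _ (fun=> 0)) !Nk !mul0r !mulr0 !mul0r !addr0 => Sp.
  apply: (mulfI s0).
  rewrite /p mulrBr [_ * (v%:R / _)]mulrC divfK //.
  apply/eqP; rewrite -subr_eq0 -[X in _ == X]Sp; apply/eqP.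
  by field.
have vE : v%:R = (2 - t - t^-1) * (k - p) by rewrite /p subKr mulrC divfK.
pose mu := \sum_x N x a * N x b * N x c.
have [S1|] := eqVneq (\sum_x (W x a / W x c) * (W x a / W x b)) 0; last by left.
have [S2|] := eqVneq (\sum_x (W x b / W x a) * (W x c / W x a)) 0; last by right.
have A1 : (t - 1) * (mu - p) + t * (k - p) = 0.
  apply: (triple_sum_eq0 t0 t1 tN1 vE); rewrite -S1.
  have WE x : (W x a / W x c) * (W x a / W x b) =
    (1 + (t ^+ 2 - 1) * N x a) * (1 + (t^-1 - 1) * N x b)
      * (1 + (t^-1 - 1) * N x c).
    by rewrite !mxE; case: (N01 x a) => ->; case: (N01 x b) => ->;
       case: (N01 x c) => ->; field; rewrite ?t0 //= ?subrK ?oner_eq0.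
  under eq_bigr do rewrite WE.
  by rewrite sum_prod3 !Nk !pE.
(* The exponents on columns [a], [b], [c] are now -2, 1, 1: the previous case with [t^-1] for
   [t]. *)
have A2 : (t^-1 - 1) * (mu - p) + t^-1 * (k - p) = 0.
  have vE' : v%:R = (2 - t^-1 - (t^-1)^-1) * (k - p).
    by rewrite vE invrK; congr (_ * _); ring.
  apply: (triple_sum_eq0 tV0 tV1 tVN1 vE'); rewrite -S2 invrK.
  have WE x : (W x b / W x a) * (W x c / W x a) =
    (1 + (t^-1 ^+ 2 - 1) * N x a) * (1 + (t - 1) * N x b)
      * (1 + (t - 1) * N x c).
    by rewrite !mxE; case: (N01 x a) => ->; case: (N01 x b) => ->;
       case: (N01 x c) => ->; field; rewrite ?t0 //= ?subrK ?oner_eq0.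
  under eq_bigr do rewrite WE.
  by rewrite sum_prod3 !Nk !pE.
(* Adding [t] times [A2] to [A1] eliminates [mu]. Then [k = p], which contradicts [v%:R != 0]
   through [vE]. *)
have /eqP : (t + 1) * (k - p) = 0.
  rewrite -[RHS](addr0 0) -[X in _ = X + _]A1 -[X in _ = _ + X](mulr0 t) -A2.
  by field.
rewrite mulf_eq0 -[1]opprK subr_eq0 (negPf tN1) /= => /eqP kp.
by move: v0; rewrite vE kp mulr0 eqxx.
Qed.

(** * From cyclic steps to a constant off-diagonal eigenvalue *)

Lemma cyclic_const (T : Type) (v : nat) (theta : 'I_v -> 'I_v -> T) :
  (3 < v)%N ->
  (forall a b c, a != b -> a != c -> b != c -> theta a b = theta c a) ->
  forall a b c d, a != b -> c != d -> theta a b = theta c d.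
Proof.
move=> v3 step.
have avoid (s : seq 'I_v) : (size s <= 3)%N -> exists c, c \notin s.
  move=> s3; apply/existsP; rewrite -negb_forall; apply/negP => /forallP sT.
  have := uniq_leq_size (enum_uniq 'I_v) (fun x _ => sT x).
  by rewrite -cardE card_ord => /leq_trans/(_ s3); rewrite leqNgt v3.
(* The path [ab], [ca], [dc], [ad], [ba] needs a fourth index: on three indices the steps only
   rotate [ab], [ca], [bc] and never reverse a pair. *)
have sym a b : a != b -> theta a b = theta b a.
  move=> ab; have [c] := avoid [:: a; b] isT.
  rewrite !inE negb_or => /andP[ca cb].
  have [d] := avoid [:: a; b; c] isT.
  rewrite !inE !negb_or => /and3P[da db dc].
  transitivity (theta c a); first by apply: step; rewrite // eq_sym.
  transitivity (theta d c); first by apply: step; rewrite // eq_sym.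
  transitivity (theta a d); first by apply: step; rewrite // eq_sym.
  by apply: step; rewrite // eq_sym.
have row a b c : a != b -> a != c -> theta a b = theta a c.
  move=> ab ac; case: (eqVneq b c) => [->//|bc].
  by rewrite (step a b c) // sym // eq_sym.
move=> a b c d ab cd; case: (eqVneq a c) => [ac|ac].
  by subst c; apply: row.
by rewrite (row a b c) // sym // (row c a d) // eq_sym.
Qed.

(** * The Nomura algebra against the span of [I] and [J] *)

(** [J] replaces each entry by the sum of all entries, which is 0 for [a != b], while [Yvec W a a]
    is the all-ones vector. *)
Lemma mul_allones (F : fieldType) (v : nat) (W : 'M[F]_v) :
  v%:R != 0 :> F -> typeII W -> forall a b,
  allones F v *m Yvec W a b = ((v%:R : F) *+ (a == b)) *: Yvec W a b.
Proof.
move=> v0 tW a b; apply/matrixP => x i; rewrite ord1 [LHS]mxE [RHS]mxE YvecE.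
under eq_bigr do rewrite mxE mul1r YvecE.
rewrite (typeII_col v0 tW); case: eqVneq => [->|_]; last by rewrite mul0r.
by rewrite divff ?mulr1 //; case: tW.
Qed.

Lemma Yvec_neq0 (F : fieldType) (v : nat) (W : 'M[F]_v) (a b : 'I_v) :
  (forall i j, W i j != 0) -> Yvec W a b != 0.
Proof.
move=> W0; apply/eqP => /matrixP/(_ a 0); rewrite YvecE mxE => /eqP.
by rewrite mulf_eq0 invr_eq0 !(negPf (W0 _ _)).
Qed.

Lemma nomura_span (F : fieldType) (v : nat) (W : 'M[F]_v) (x y : F) :
  v%:R != 0 :> F -> typeII W -> nomura W (x%:M + y *: allones F v).
Proof.
move=> v0 tW a b; split; first by apply: Yvec_neq0; case: tW.
exists (x + y * ((v%:R : F) *+ (a == b))).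
by rewrite mulmxDl mul_scalar_mx -scalemxAl mul_allones // scalerA scalerDl.
Qed.

(** Dividing a single nonzero coordinate recovers each eigenvalue, which gives [theta] as a function
    without choice. *)
Lemma nomura_eigenvalues (F : fieldType) (v : nat) (W M : 'M[F]_v) :
  (forall i j, W i j != 0) -> nomura W M ->
  {theta : 'I_v -> 'I_v -> F |
    forall a b, M *m Yvec W a b = theta a b *: Yvec W a b}.
Proof.
move=> W0 nM; exists (fun a b => (M *m Yvec W a b) a 0 / Yvec W a b a 0) => a b.
have [_ [th Mth]] := nM a b.
rewrite {2}Mth (mxE scalemx_key) mulfK // YvecE.
by rewrite mulf_neq0 ?invr_eq0.
Qed.

Lemma design_nomura_trivial (F : fieldType) (v : nat) (N : 'M[F]_v) (t k : F)
    (W := (t - 1) *: N + allones F v) (M : 'M[F]_v) :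
  v%:R != 0 :> F -> (3 < v)%N ->
  (forall i j, N i j = 0 \/ N i j = 1) ->
  (forall j, \sum_i N i j = k) ->
  typeII W -> t != -1 -> nomura W M ->
  exists x y, M = x%:M + y *: allones F v.
Proof.
move=> v0 v3 N01 Nk tW tN1 nM; have v1 : (1 < v)%N by apply: leq_trans v3.
have [theta Mth] := nomura_eigenvalues tW.1 nM.
have const := cyclic_const v3 (theta := theta).
have {}const a b c d : a != b -> c != d -> theta a b = theta c d.
  apply: const => {}a {}b {}c ab ac bc.
  have [S0|S0] := design_adjacent v0 v1 N01 Nk tW tN1 ab ac bc.
    exact: (eigenvalue_eq v0 tW Mth S0).
  exact/esym/(eigenvalue_eq v0 tW Mth S0).
pose i0 := Ordinal (ltnW v1); pose i1 := Ordinal v1.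
(* [x] is the common off-diagonal eigenvalue, and [y] solves [x + y v = theta i0 i0], so both
   matrices agree on the basis [Yvec W c i0]. *)
pose x := theta i1 i0; pose y := (theta i0 i0 - x) / v%:R.
exists x, y.
apply: (can_inj (mulmxK (Ybasis_unit i0 v0 tW))).
apply: eq_col => c; rewrite !col_mulmx col_Ybasis Mth.
rewrite mulmxDl mul_scalar_mx -scalemxAl mul_allones // scalerA -scalerDl; congr (_ *: _).
case: (eqVneq c i0) => [->|ci]; first by rewrite mulr1n divfK // addrC subrK.
by rewrite mulr0n mulr0 addr0; apply: const.
Qed.

Lemma free_1_allones (F : fieldType) (v : nat) :
  (1 < v)%N -> free [:: 1%:M; allones F v].
Proof.
move=> v1; pose i0 := Ordinal (ltnW v1); pose i1 := Ordinal v1.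
rewrite free_cons span_seq1 seq1_free; apply/andP; split.
  apply/negP => /vlineP[c /matrixP E].
  have := E i0 i1; rewrite !mxE mulr1 /= => c0.
  by have := E i0 i0; rewrite !mxE mulr1 /= -c0 => /eqP; rewrite oner_eq0.
by apply/eqP => /matrixP/(_ i0 i0); rewrite !mxE => /eqP; rewrite oner_eq0.
Qed.

Lemma mem_span_1_allones (F : fieldType) (v : nat) (M : 'M[F]_v) :
  M \in <<[:: 1%:M; allones F v]>>%VS <->
  exists x y, M = x%:M + y *: allones F v.
Proof.
rewrite span_cons span_seq1; split.
  move=> /memv_addP[_ /vlineP[x ->] [_ /vlineP[y ->] ->]].
  by exists x, y; rewrite scalemx1.
move=> [x [y ->]]; rewrite -scalemx1.
apply: memv_add; apply: memvZ; exact: memv_line.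
Qed.

Theorem theorem6p4 (R : realType) (v k lambda : nat) (N : 'M[complex R]_v)
  (t : complex R) :
  symmetric_design k lambda N ->
  typeII ((t - 1) *: N + allones (complex R) v) ->
  (3 < v)%N ->
  t != -1 ->
  exists U : {vspace 'M[complex R]_v},
    [/\ is_carrier (nomura ((t - 1) *: N + allones (complex R) v)) U,
        \dim U = 2%N
      & U = <<[:: 1%:M; allones (complex R) v]>>%VS].
Proof.
move=> [_ N01 _ Nk _] tW v3 tN1.
have v1 : (1 < v)%N by apply: leq_trans v3.
have v0 : v%:R != 0 :> complex R by rewrite pnatr_eq0 -lt0n ltnW.
exists <<[:: 1%:M; allones (complex R) v]>>%VS; split=> //; last first.
  exact/eqP/free_1_allones.
move=> M; split=> [nM | /mem_span_1_allones[x [y ->]]].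
  apply/mem_span_1_allones.
  exact: (design_nomura_trivial v0 v3 N01 Nk tW tN1 nM).
exact: nomura_span.
Qed.
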